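(* Let $X=\mathbb{Z}[\frac12]\cap(0,1)$ with the action of Thompson's group $F$ and root $p=\frac58$. For $i\ge1$ let $\varphi_i:X\to\mathbb{R}$ be positive superharmonic functions satisfying $\varphi_i(q)\le\varphi_i(p)$ for all $q\in X$, such that $\sum_{i=1}^\infty\varphi_i(p)<\infty$, and let $f_i$ be the corresponding min-functions. Then for $f=\sum_{i=1}^\infty f_i$ there is a sequence $\{E_n\}$ in $\mathcal{P}_f(X)$ satisfying $\frac{f(gE_n)}{f(E_n)}\to1$ as $n\to\infty$ for all $g\in\mathcal{P}_f(X)\rtimes F$.
   Context: Thompson's group $F$ is the group of orientation-preserving piecewise linear homeomorphisms of $[0,1]$ with finitely many breakpoints, all dyadic rationals, and all slopes integer powers of $2$; it acts on $X=\mathbb{Z}[\frac12]\cap(0,1)$. It is generated by $a$ and $b$, where $a(x)=2x$ on $[0,\frac14]$, $a(x)=\frac x2+\frac38$ on $[\frac14,\frac34]$, $a(x)=x$ on $[\frac34,1]$; and $b(x)=x$ on $[0,\frac12]$, $b(x)=\frac x2+\frac14$ on $[\frac12,\frac34]$, $b(x)=x-\frac18$ on $[\frac34,\frac78]$, $b(x)=2x-1$ on $[\frac78,1]$. Root: $p=\frac58$. A function $\varphi:X\to\mathbb{R}$ is superharmonic if $\varphi(x)\ge\frac14(\varphi(ax)+\varphi(bx)+\varphi(a^{-1}x)+\varphi(b^{-1}x))$ for all $x\in X$. $\mathcal{P}_f(X)$ is the set of finite subsets of $X$. The lamplighter group $\mathcal{P}_f(X)\rtimes F$ has multiplication $(E,g)(E',h)=(E\,\Delta\,gE',gh)$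 and acts on $\mathcal{P}_f(X)$ by $(E,g)(E')=E\,\Delta\,gE'$. The min-function of $\varphi$ is $f:\mathcal{P}_f(X)\to\mathbb{R}$, $f(E)=\min_{x\in E}\varphi(x)$ for $E\ne\varnothing$, $f(\varnothing)=\varphi(p)$. *)

(* Defs.v *)
From HB Require Import structures.
From mathcomp Require Import all_boot all_order all_algebra finmap.
From mathcomp Require Import all_classical all_reals all_analysis.
From mathcomp Require Import ring lra.
Import Order.TTheory GRing.Theory Num.Theory.
Import numFieldNormedType.Exports.

Set Implicit Arguments.
Unset Strict Implicit.
Unset Printing Implicit Defensive.

Local Open Scope classical_set_scope.
Local Open Scope ring_scope.

Definition dyadic (R : realType) (x : R) : Prop :=
  exists (m : int) (n : nat), x = m%:~R / 2 ^+ n.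

(* An orientation-preserving homeomorphism of [0, 1] is encoded by its
   extension to R by the identity, so that extensionally equal homeomorphisms
   are equal as functions. *)
Definition homeo01 (R : realType) (g : R -> R) : Prop :=
  [/\ continuous g,
      exists h, [/\ continuous h, cancel g h & cancel h g],
      {homo g : x y / x < y}
    & forall x, ~~ (0 <= x <= 1) -> g x = x].

(* [s] contains all the breakpoints: [g] is affine, with slope a power of 2, on
   each subinterval of [0, 1] whose interior avoids [s]. *)
Definition dyadic_pl01 (R : realType) (g : R -> R) : Prop :=
  exists s : seq R,
    (forall t, t \in s -> dyadic t) /\
    forall u v, 0 <= u -> u < v -> v <= 1 ->
      (forall t, t \in s -> ~~ (u < t < v)) ->
      exists (k : int) (c : R), forall x, u <= x <= v -> g x = 2 ^ k * x + c.

Record thompsonF (R : realType) := ThompsonF {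
  thompson_fun :> R -> R ;
  thompson_homeo : homeo01 thompson_fun ;
  thompson_pl : dyadic_pl01 thompson_fun
}.

HB.instance Definition _ (R : realType) := gen_eqMixin (thompsonF R).
HB.instance Definition _ (R : realType) := gen_choiceMixin (thompsonF R).

Section Homeo.
Variable R : realType.
Implicit Types g h : R -> R.

Lemma thompson_inj (g h : thompsonF R) : g =1 h -> g = h.
Proof.
case: g h => [g g1 g2] [h h1 h2] /= /funext E; case: _ / E in h1 h2 *.
by rewrite (Prop_irrelevance g1 h1) (Prop_irrelevance g2 h2).
Qed.

Lemma homo_lt_cancel g h : cancel h g -> {homo g : x y / x < y} ->
  {homo h : x y / x < y}.
Proof.
move=> hK gi x y xy; rewrite ltNge; apply/negP.
rewrite le_eqVlt => /orP[/eqP e|/gi]; first by move: xy; rewrite -(hK x) -e hK ltxx.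
by rewrite !hK => /(lt_trans xy); rewrite ltxx.
Qed.

Lemma homo_lt_continuous g h : cancel g h -> cancel h g ->
  {homo g : x y / x < y} -> continuous g.
Proof.
move=> gK hK gi x; apply/cvgrPdist_lt => e e0.
have hi := homo_lt_cancel hK gi.
have l : h (g x - e) < x by rewrite -[ltRHS]gK; apply: hi; lra.
have r : x < h (g x + e) by rewrite -[ltLHS]gK; apply: hi; lra.
near=> y.
have ly : h (g x - e) < y by near: y; exact: lt_nbhsr.
have yr : y < h (g x + e) by near: y; exact: lt_nbhsl.
have := gi _ _ ly; have := gi _ _ yr; rewrite !hK => ? ?.
by rewrite ltr_norml; lra.
Unshelve. all: by end_near. Qed.

Lemma homeo01_of_cancel g h : cancel g h -> cancel h g ->
  {homo g : x y / x < y} -> (forall x, ~~ (0 <= x <= 1) -> g x = x) ->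
  homeo01 g.
Proof.
move=> gK hK gi g1; split => //; first exact: homo_lt_continuous gK hK gi.
exists h; split => //.
exact: homo_lt_continuous hK gK (homo_lt_cancel hK gi).
Qed.

Lemma homeo01_le g : homeo01 g -> {mono g : x y / x <= y}.
Proof. by case=> _ _ gi _; exact: le_mono. Qed.

Lemma homeo01_lt g : homeo01 g -> {mono g : x y / x < y}.
Proof. by move=> /homeo01_le/leW_mono. Qed.

Lemma homeo01_itv g x : homeo01 g -> (0 <= g x <= 1) = (0 <= x <= 1).
Proof.
move=> Hg; have [_ [h [_ gK hK]] _ g1] := Hg.
apply/idP/idP; last first.
  apply: contraTT => gx; have e : g (g x) = g x by exact: g1.
  by move: gx; rewrite (can_inj gK e).
by apply: contraTT => nx; rewrite g1.
Qed.

Lemma homeo01_0 g : homeo01 g -> g 0 = 0.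
Proof.
move=> Hg; have [_ [h [_ gK hK]] _ g1] := Hg.
have /andP[g0 _] : 0 <= g 0 <= 1 by rewrite homeo01_itv // lexx ler01.
have /andP[h0 _] : 0 <= h 0 <= 1 by rewrite -(homeo01_itv _ Hg) hK lexx ler01.
by apply/eqP; rewrite eq_le g0 andbT -[leRHS]hK homeo01_le.
Qed.

Lemma homeo01_1 g : homeo01 g -> g 1 = 1.
Proof.
move=> Hg; have [_ [h [_ gK hK]] _ g1] := Hg.
have /andP[_ g0] : 0 <= g 1 <= 1 by rewrite homeo01_itv // lexx ler01.
have /andP[_ h0] : 0 <= h 1 <= 1 by rewrite -(homeo01_itv _ Hg) hK lexx ler01.
by apply/eqP; rewrite eq_le g0 /= -[leLHS]hK homeo01_le.
Qed.

Lemma dyadicD (x y : R) : dyadic x -> dyadic y -> dyadic (x + y).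
Proof.
move=> [m [n ->]] [m' [n' ->]].
exists (m * 2 ^+ n' + m' * 2 ^+ n), (n + n')%N.
rewrite exprD rmorphD !rmorphM !rmorphXn /=.
have ? : (2 : R) ^+ n != 0 by rewrite expf_neq0.
have ? : (2 : R) ^+ n' != 0 by rewrite expf_neq0.
by field; apply/andP.
Qed.

Lemma dyadicN (x : R) : dyadic x -> dyadic (- x).
Proof. by move=> [m [n ->]]; exists (- m), n; rewrite rmorphN mulNr. Qed.

Lemma dyadicMX (x : R) (k : int) : dyadic x -> dyadic (2 ^ k * x).
Proof.
move=> [m [n ->]]; case: k => k.
  by exists (2 ^+ k * m), n; rewrite rmorphM rmorphXn /= mulrA -exprnP.
exists m, (n + k.+1)%N; rewrite NegzE -exprnN exprD invfM.
by rewrite mulrC -mulrA.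
Qed.

Lemma dyadic0 : dyadic (0 : R).
Proof. by exists 0, 0%N; rewrite mul0r. Qed.

Lemma homeo01_dyadic g x : homeo01 g -> dyadic_pl01 g ->
  0 <= x <= 1 -> dyadic x -> dyadic (g x).
Proof.
move=> Hg [s [sd sp]].
have [n] := ubnP (count (fun t => 0 < t < x) s); elim: n x => // n IH x.
rewrite ltnS => cx /andP[x0 x1] dx.
have [->|/eqP xn0] := eqVneq x 0; first by rewrite homeo01_0 //; exact: dyadic0.
have {xn0}x0 : 0 < x by rewrite lt_neqAle x0 eq_sym; move/eqP: xn0 => ->.
have step u : 0 <= u -> u < x -> (forall t, t \in s -> ~~ (u < t < x)) ->
    dyadic u -> dyadic (g u) -> dyadic (g x).
  move=> u0 ux su du dgu.
  have [k [c kc]] := sp u x u0 ux x1 su.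
  have -> : g x = g u + 2 ^ k * (x + - u).
    by rewrite (kc x) ?(kc u) ?lexx ?ltW //; ring.
  by apply: dyadicD => //; apply/dyadicMX/dyadicD => //; exact: dyadicN.
pose t := \big[Num.max/0]_(i <- [seq i <- s | 0 < i < x]) i.
have tmax i : i \in s -> 0 < i < x -> i <= t.
  by move=> is_ ix; rewrite /t; apply: le_bigmax_seq => //; rewrite mem_filter ix.
have [e|[ts tx]] : t = 0 \/ (t \in s /\ 0 < t < x).
  suff : t = 0 \/ t \in [seq i <- s | 0 < i < x].
    by rewrite mem_filter => -[?|/andP[? ?]]; [left|right].
  rewrite /t; elim: [seq i <- s | _] => [|i l IHl]; first by left; rewrite big_nil.
  rewrite big_cons; set m := \big[_/_]_(_ <- l) _ in IHl *.
  have [|] := leP i m; last by right; rewrite inE eqxx.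
  by case: IHl => [?|ml]; [left|right; rewrite inE ml orbT].
- apply: (step 0); rewrite ?lexx ?homeo01_0 //; do ?exact: dyadic0.
  move=> i is_; apply/negP => ix; have := tmax i is_ ix.
  by rewrite e leNgt; case/andP: ix => ->.
- have /andP[t0 tltx] := tx; apply: (step t); rewrite ?ltW //.
  + move=> i is_; apply/negP => /andP[ti ix].
    by have := tmax i is_; rewrite (lt_trans t0 ti) ix leNgt ti => /(_ isT).
  + exact: sd.
  + apply: IH; [|by rewrite ltW //= ltW // (lt_le_trans tltx)|exact: sd].
    apply: leq_trans cx.
    rewrite -!size_filter.
    have -> : [seq i <- s | 0 < i < t] =
        [seq i <- [seq i <- s | 0 < i < x] | i < t].
      rewrite -filter_predI; apply: eq_filter => i /=.
      case: (ltP i t) => it; last by rewrite andbF.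
      by rewrite (lt_trans it tltx) andbT.
    rewrite [ltnLHS]size_filter ltn_neqAle count_size andbT.
    rewrite -all_count; apply/negP => /allP/(_ t).
    by rewrite mem_filter tx ts ltxx => /(_ isT).
Qed.

Lemma homeo01_id : homeo01 (@id R).
Proof. exact: (@homeo01_of_cancel id id). Qed.

Lemma dyadic_pl01_id : dyadic_pl01 (@id R).
Proof.
exists [::]; split => // u v _ _ _ _; exists 0, 0 => x _.
by rewrite expr0z mul1r addr0.
Qed.

Lemma homeo01_comp g h : homeo01 g -> homeo01 h -> homeo01 (g \o h).
Proof.
move=> [_ [g' [_ gK g'K]] gi g1] [_ [h' [_ hK h'K]] hi h1].
apply: (@homeo01_of_cancel _ (h' \o g')).
- exact: can_comp.
- exact: can_comp.
- by move=> x y /hi/gi.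
- by move=> x nx /=; rewrite h1 // g1.
Qed.

Lemma homeo01_inv g h : homeo01 g -> cancel g h -> cancel h g -> homeo01 h.
Proof.
move=> [_ _ gi g1] gK hK; apply: (homeo01_of_cancel hK gK).
  exact: homo_lt_cancel hK gi.
by move=> x nx; rewrite -[in LHS](g1 x nx) gK.
Qed.

Lemma dyadic_pl01_inv g h : homeo01 g -> cancel g h -> cancel h g ->
  dyadic_pl01 g -> dyadic_pl01 h.
Proof.
move=> Hg gK hK pg; have Hh := homeo01_inv Hg gK hK.
have [s [sd sp]] := pg.
exists (map g [seq t <- s | 0 <= t <= 1]); split=> [t /mapP[u]|u v u0 uv v1 nt].
  rewrite mem_filter => /andP[u01 us] ->.
  by apply: homeo01_dyadic => //; exact: sd.
have hu0 : 0 <= h u by rewrite -(homeo01_0 Hh) homeo01_le.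
have hv1 : h v <= 1 by rewrite -(homeo01_1 Hh) homeo01_le.
have huv : h u < h v by rewrite homeo01_lt.
have [|k [c kc]] := sp _ _ hu0 huv hv1.
  move=> t ts; apply/negP => /andP[ut tv].
  have := nt (g t); rewrite map_f; last first.
    by rewrite mem_filter ts (ltW (le_lt_trans hu0 ut)) (ltW (lt_le_trans tv hv1)).
  by move=> /(_ isT); rewrite -{1}[u]hK -[v]hK !homeo01_lt // ut tv.
exists (- k), (- (2 ^ (- k) * c)) => x /andP[ux xv].
have := kc (h x); rewrite !homeo01_le // ux xv hK => /(_ isT) e.
have k0 : (2 : R) ^ k != 0 by rewrite expfz_neq0.
by rewrite [in RHS]e -invr_expz; field.
Qed.

Lemma dyadic_pl01_comp g h : homeo01 g -> homeo01 h ->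
  dyadic_pl01 g -> dyadic_pl01 h -> dyadic_pl01 (g \o h).
Proof.
move=> Hg Hh [s [sd sp]] ph; have [_ [h' [_ hK h'K]] _ _] := Hh.
have Hh' := homeo01_inv Hh hK h'K; have ph' := dyadic_pl01_inv Hh hK h'K ph.
have [r [rd rp]] := ph.
exists (r ++ map h' [seq t <- s | 0 <= t <= 1]); split=> [t|u v u0 uv v1 nt].
  rewrite mem_cat => /orP[/rd//|/mapP[w]].
  rewrite mem_filter => /andP[w01 ws] ->.
  by apply: homeo01_dyadic => //; exact: sd.
have [|k [c kc]] := rp _ _ u0 uv v1.
  by move=> t tr; apply: nt; rewrite mem_cat tr.
have hu0 : 0 <= h u by rewrite -(homeo01_0 Hh) homeo01_le.
have hv1 : h v <= 1 by rewrite -(homeo01_1 Hh) homeo01_le.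
have huv : h u < h v by rewrite homeo01_lt.
have [|k' [c' kc']] := sp _ _ hu0 huv hv1.
  move=> t ts; apply/negP => /andP[ut tv].
  have := nt (h' t); rewrite mem_cat map_f ?orbT; last first.
    by rewrite mem_filter ts (ltW (le_lt_trans hu0 ut)) (ltW (lt_le_trans tv hv1)).
  by move=> /(_ isT); rewrite -[u]hK -[v]hK !homeo01_lt // ut tv.
exists (k' + k), (2 ^ k' * c + c') => x /andP[ux xv] /=.
rewrite kc' ?homeo01_le ?ux // kc ?ux // expfzDr //.
by ring.
Qed.

End Homeo.

Section ThompsonGroup.
Variable R : realType.
Implicit Types g h : thompsonF R.

Definition thompson_one : thompsonF R :=
  ThompsonF (homeo01_id R) (dyadic_pl01_id R).

Definition thompson_mul g h : thompsonF R :=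
  ThompsonF (homeo01_comp (thompson_homeo g) (thompson_homeo h))
    (dyadic_pl01_comp (thompson_homeo g) (thompson_homeo h)
      (thompson_pl g) (thompson_pl h)).

Lemma thompson_invP g : exists h : thompsonF R, cancel g h /\ cancel h g.
Proof.
have [_ [h [_ gK hK]] _ _] := thompson_homeo g.
have Hh := homeo01_inv (thompson_homeo g) gK hK.
by exists (ThompsonF Hh (dyadic_pl01_inv (thompson_homeo g) gK hK (thompson_pl g))).
Qed.

Definition thompson_inv g : thompsonF R := sval (cid (thompson_invP g)).

Lemma thompson_invK g : cancel g (thompson_inv g) /\ cancel (thompson_inv g) g.
Proof. exact: svalP (cid (thompson_invP g)). Qed.

Lemma thompson_mulA : associative thompson_mul.
Proof. by move=> f g h; apply: thompson_inj. Qed.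

Lemma thompson_mul1 : left_id thompson_one thompson_mul.
Proof. by move=> g; apply: thompson_inj. Qed.

Lemma thompson_mulr1 : right_id thompson_one thompson_mul.
Proof. by move=> g; apply: thompson_inj. Qed.

Lemma thompson_mulV : left_inverse thompson_one thompson_inv thompson_mul.
Proof. by move=> g; apply: thompson_inj => x /=; exact: (thompson_invK g).1. Qed.

Lemma thompson_mulrV : right_inverse thompson_one thompson_inv thompson_mul.
Proof. by move=> g; apply: thompson_inj => x /=; exact: (thompson_invK g).2. Qed.

HB.instance Definition _ := isGroup.Build (thompsonF R) thompson_mulA
  thompson_mul1 thompson_mulr1 thompson_mulV thompson_mulrV.

End ThompsonGroup.

Section Generators.
Variable R : realType.

Definition afun (x : R) : R :=
  if x <= 0 then x else
  if x <= 1 / 4 then 2 * x else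
  if x <= 3 / 4 then x / 2 + 3 / 8 else x.

Definition bfun (x : R) : R :=
  if x <= 1 / 2 then x else
  if x <= 3 / 4 then x / 2 + 1 / 4 else
  if x <= 7 / 8 then x - 1 / 8 else
  if x <= 1 then 2 * x - 1 else x.

Let afun' (x : R) : R :=
  if x <= 0 then x else
  if x <= 1 / 2 then x / 2 else
  if x <= 3 / 4 then 2 * x - 3 / 4 else x.

Let bfun' (x : R) : R :=
  if x <= 1 / 2 then x else
  if x <= 5 / 8 then 2 * x - 1 / 2 else
  if x <= 3 / 4 then x + 1 / 8 else
  if x <= 1 then (x + 1) / 2 else x.

Let glue (c : R) (f g : R -> R) (x : R) : R := if x <= c then f x else g x.

Let glue_homo (c : R) (f g : R -> R) :
  {homo f : x y / x < y} -> {homo g : x y / x < y} -> f c = g c ->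
  {homo glue c f g : x y / x < y}.
Proof.
move=> fi gi fg x y xy; rewrite /glue.
have [yc|cy] := leP y c; first by rewrite (le_trans (ltW xy) yc) fi.
have [xc|cx] := leP x c; last exact: gi.
by rewrite (le_lt_trans _ (gi _ _ cy)) // -fg le_eqVlt;
  move: xc; rewrite le_eqVlt => /orP[/eqP->|/fi->]; rewrite ?eqxx ?orbT.
Qed.

Let glue_cancel (c : R) (f g f' g' : R -> R) (d : R) :
  {homo f : x y / x < y} -> {homo g : x y / x < y} -> f c = d -> g c = d ->
  cancel f f' -> cancel g g' -> cancel (glue c f g) (glue d f' g').
Proof.
move=> fi gi fc gc fK gK x; rewrite /glue.
have [xc|cx] := leP x c; last by rewrite -gc leNgt gi //= gK.
rewrite -fc ifT ?fK //.
by move: xc; rewrite le_eqVlt => /orP[/eqP->|/fi/ltW].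
Qed.

Let id_homo : {homo (fun x : R => x) : x y / x < y}.
Proof. by []. Qed.

Let half_homo (c : R) : {homo (fun x => x / 2 + c) : x y / x < y}.
Proof. by move=> x y xy; lra. Qed.

Let half0_homo : {homo (fun x : R => x / 2) : x y / x < y}.
Proof. by move=> x y xy; lra. Qed.

Let double_homo (c : R) : {homo (fun x => 2 * x - c) : x y / x < y}.
Proof. by move=> x y xy; lra. Qed.

Let double0_homo : {homo (fun x : R => 2 * x) : x y / x < y}.
Proof. by move=> x y xy; lra. Qed.

Let shiftN_homo (c : R) : {homo (fun x => x - c) : x y / x < y}.
Proof. by move=> x y xy; lra. Qed.

Let shift_homo (c : R) : {homo (fun x => x + c) : x y / x < y}.
Proof. by move=> x y xy; lra. Qed.

Let halfD_homo (c : R) : {homo (fun x => (x + c) / 2) : x y / x < y}.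
Proof. by move=> x y xy; lra. Qed.

Ltac homo_tac := solve [ exact: id_homo | exact: half_homo | exact: half0_homo
  | exact: double_homo | exact: double0_homo | exact: shiftN_homo
  | exact: shift_homo | exact: halfD_homo
  | apply: glue_homo; [homo_tac | homo_tac | by rewrite /glue ?ifT; lra] ].

Ltac cancel_tac := solve [ by []
  | by move=> x /=; lra
  | apply: glue_cancel; [ homo_tac | homo_tac | by rewrite /glue ?ifT; lra
      | by rewrite /glue ?ifT; lra | cancel_tac | cancel_tac ] ].

Lemma afun_homeo : homeo01 afun.
Proof.
apply: (@homeo01_of_cancel _ _ afun').
- change (cancel (glue 0 id (glue (1/4) (fun x => 2 * x)
    (glue (3/4) (fun x => x / 2 + 3/8) id)))
    (glue 0 id (glue (1/2) (fun x => x / 2)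
    (glue (3/4) (fun x => 2 * x - 3/4) id)))).
  cancel_tac.
- change (cancel (glue 0 id (glue (1/2) (fun x => x / 2)
    (glue (3/4) (fun x => 2 * x - 3/4) id)))
    (glue 0 id (glue (1/4) (fun x => 2 * x)
    (glue (3/4) (fun x => x / 2 + 3/8) id)))).
  cancel_tac.
- change {homo (glue 0 id (glue (1/4) (fun x => 2 * x)
    (glue (3/4) (fun x => x / 2 + 3/8) id))) : x y / x < y}.
  homo_tac.
- move=> x; rewrite negb_and -!ltNge /afun => /orP[x0|x1]; first by rewrite ltW.
  by rewrite !ifF //; apply/negbTE; rewrite -ltNge; lra.
Qed.

Lemma bfun_homeo : homeo01 bfun.
Proof.
apply: (@homeo01_of_cancel _ _ bfun').
- change (cancel (glue (1/2) id (glue (3/4) (fun x => x / 2 + 1/4)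
    (glue (7/8) (fun x => x - 1/8) (glue 1 (fun x => 2 * x - 1) id))))
    (glue (1/2) id (glue (5/8) (fun x => 2 * x - 1/2)
    (glue (3/4) (fun x => x + 1/8) (glue 1 (fun x => (x + 1) / 2) id))))).
  cancel_tac.
- change (cancel
    (glue (1/2) id (glue (5/8) (fun x => 2 * x - 1/2)
    (glue (3/4) (fun x => x + 1/8) (glue 1 (fun x => (x + 1) / 2) id))))
    (glue (1/2) id (glue (3/4) (fun x => x / 2 + 1/4)
    (glue (7/8) (fun x => x - 1/8) (glue 1 (fun x => 2 * x - 1) id))))).
  cancel_tac.
- change {homo (glue (1/2) id (glue (3/4) (fun x => x / 2 + 1/4)
    (glue (7/8) (fun x => x - 1/8) (glue 1 (fun x => 2 * x - 1) id))))
    : x y / x < y}.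
  homo_tac.
- move=> x; rewrite negb_and -!ltNge /bfun => /orP[x0|x1].
    by rewrite ifT //; lra.
  by rewrite !ifF //; apply/negbTE; rewrite -ltNge; lra.
Qed.

Let exp2z1 : (2 : R) ^ (-1) = 1 / 2.
Proof. by rewrite exprN1 mul1r. Qed.

Lemma dyadic_quot (m n : nat) : dyadic (m%:R / 2 ^+ n : R).
Proof. by exists m%:Z, n. Qed.

Lemma afun_pl : dyadic_pl01 afun.
Proof.
exists [:: 1 / 4; 3 / 4]; split.
  move=> t; rewrite !inE => /orP[]/eqP->.
  - by have -> : 1 / 4 = 1%:R / 2 ^+ 2 :> R; [lra|exact: dyadic_quot].
  - by have -> : 3 / 4 = 3%:R / 2 ^+ 2 :> R; [lra|exact: dyadic_quot].
move=> u v u0 _ _ nt.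
have := nt (1 / 4); have := nt (3 / 4); rewrite !inE !eqxx ?orbT.
rewrite !negb_and -!leNgt => /(_ isT) n2 /(_ isT) n1; rewrite /afun.
have [v1|v1] := leP v (1 / 4).
  exists 1, 0 => x /andP[ux xv]; rewrite expr1z; clear n1 n2.
  by have [?|?] := leP x 0; [lra|rewrite ifT; lra].
have {n1}u1 : 1 / 4 <= u by case/orP: n1 => //; rewrite leNgt v1.
have [v2|v2] := leP v (3 / 4).
  exists (-1), (3 / 8) => x /andP[ux xv]; rewrite exp2z1 ifF; last first.
    by apply/negbTE; rewrite -ltNge; lra.
  by have [?|?] := leP x (1 / 4); [lra|rewrite ifT; lra].
have {n2}u2 : 3 / 4 <= u by case/orP: n2 => //; rewrite leNgt v2.
exists 0, 0 => x /andP[ux _]; rewrite expr0z.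
have [?|_] := leP x 0; first by lra.
have [?|_] := leP x (1 / 4); first by lra.
by have [?|?] := leP x (3 / 4); lra.
Qed.

Lemma bfun_pl : dyadic_pl01 bfun.
Proof.
exists [:: 1 / 2; 3 / 4; 7 / 8]; split.
  move=> t; rewrite !inE => /or3P[]/eqP->.
  - by have -> : 1 / 2 = 1%:R / 2 ^+ 1 :> R; [lra|exact: dyadic_quot].
  - by have -> : 3 / 4 = 3%:R / 2 ^+ 2 :> R; [lra|exact: dyadic_quot].
  - by have -> : 7 / 8 = 7%:R / 2 ^+ 3 :> R; [lra|exact: dyadic_quot].
move=> u v _ _ vle1 nt.
have := nt (1 / 2); have := nt (3 / 4); have := nt (7 / 8).
rewrite !inE !eqxx ?orbT !negb_and -!leNgt.
move=> /(_ isT) n3 /(_ isT) n2 /(_ isT) n1; rewrite /bfun.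
have [v1|v1] := leP v (1 / 2).
  by exists 0, 0 => x /andP[_ xv]; rewrite expr0z ifT; lra.
have {n1}u1 : 1 / 2 <= u by case/orP: n1 => //; rewrite leNgt v1.
have [v2|v2] := leP v (3 / 4).
  exists (-1), (1 / 4) => x /andP[ux xv]; rewrite exp2z1.
  by have [?|?] := leP x (1 / 2); [lra|rewrite ifT; lra].
have {n2}u2 : 3 / 4 <= u by case/orP: n2 => //; rewrite leNgt v2.
have [v3|v3] := leP v (7 / 8).
  exists 0, (- (1 / 8)) => x /andP[ux xv]; rewrite expr0z ifF; last first.
    by apply/negbTE; rewrite -ltNge; lra.
  by have [?|?] := leP x (3 / 4); [lra|rewrite ifT; lra].
have {n3}u3 : 7 / 8 <= u by case/orP: n3 => //; rewrite leNgt v3.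
exists 1, (- 1) => x /andP[ux xv]; rewrite expr1z.
have [?|_] := leP x (1 / 2); first by lra.
have [?|_] := leP x (3 / 4); first by lra.
by have [?|?] := leP x (7 / 8); [lra|rewrite ifT; lra].
Qed.

Definition thompson_a : thompsonF R := ThompsonF afun_homeo afun_pl.
Definition thompson_b : thompsonF R := ThompsonF bfun_homeo bfun_pl.

End Generators.

Definition dyadic01 (R : realType) : set R :=
  [set x | dyadic x /\ 0 < x < 1].
Arguments dyadic01 R : clear implicits.

Section Action.
Variable R : realType.
Local Notation X := (dyadic01 R).

Lemma thompson_act_subproof (g : thompsonF R) (x : X) : g (val x) \in X.
Proof.
have /set_mem[dx /andP[x0 x1]] := valP x; have Hg := thompson_homeo g.
apply/mem_set; split; last first.
  have := homeo01_lt Hg 0 (val x); have := homeo01_lt Hg (val x) 1.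
  by rewrite homeo01_0 // homeo01_1 // x0 x1 => -> ->.
apply: homeo01_dyadic => //; first exact: thompson_pl.
by rewrite !ltW.
Qed.

Definition thompson_act (g : thompsonF R) (x : X) : X :=
  SigSub (thompson_act_subproof g x).

Lemma thompson_root_subproof : (5 / 8 : R) \in X.
Proof.
apply/mem_set; split; last lra.
by have -> : 5 / 8 = 5%:R / 2 ^+ 3 :> R; [lra|exact: dyadic_quot].
Qed.

Definition thompson_root : X := SigSub thompson_root_subproof.

Definition superharmonic (phi : X -> R) : Prop :=
  forall x : X,
    1 / 4 * (phi (thompson_act (thompson_a R) x)
             + phi (thompson_act (thompson_b R) x)
             + phi (thompson_act (thompson_a R)^-1%g x)
             + phi (thompson_act (thompson_b R)^-1%g x)) <= phi x.

Definition fset_act (g : thompsonF R) (E : {fset X}) : {fset X} :=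
  [fset thompson_act g x | x in E]%fset.

Definition fsymdiff (E E' : {fset X}) : {fset X} :=
  ((E `\` E') `|` (E' `\` E))%fset.

Lemma thompson_act1 (x : X) : thompson_act 1%g x = x.
Proof. exact: val_inj. Qed.

Lemma thompson_actM (g h : thompsonF R) (x : X) :
  thompson_act (g * h)%g x = thompson_act g (thompson_act h x).
Proof. exact: val_inj. Qed.

Lemma thompson_actK (g : thompsonF R) :
  cancel (thompson_act g) (thompson_act g^-1%g).
Proof. by move=> x; rewrite -thompson_actM mulVg thompson_act1. Qed.

Lemma in_fset_act (g : thompsonF R) (E : {fset X}) (x : X) :
  (x \in fset_act g E) = (thompson_act g^-1%g x \in E).
Proof.
apply/imfsetP/idP => [[y yE ->]|xE]; first by rewrite thompson_actK.
by exists (thompson_act g^-1%g x); rewrite // -thompson_actM mulgV thompson_act1.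
Qed.

Lemma in_fsymdiff (E E' : {fset X}) (x : X) :
  (x \in fsymdiff E E') = (x \in E) (+) (x \in E').
Proof. by rewrite !inE; case: (x \in E); case: (x \in E'). Qed.

Record lamplighter := Lamplighter {
  lamps : {fset X} ;
  position : thompsonF R
}.

HB.instance Definition _ := gen_eqMixin lamplighter.
HB.instance Definition _ := gen_choiceMixin lamplighter.

Definition lamplighter_one : lamplighter := Lamplighter fset0 1%g.

Definition lamplighter_mul (u v : lamplighter) : lamplighter :=
  Lamplighter (fsymdiff (lamps u) (fset_act (position u) (lamps v)))
    (position u * position v)%g.

Definition lamplighter_inv (u : lamplighter) : lamplighter :=
  Lamplighter (fset_act (position u)^-1%g (lamps u)) (position u)^-1%g.

Let lamplighter_eq (u v : lamplighter) :
  lamps u =i lamps v -> position u = position v -> u = v.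
Proof. by case: u v => [E g] [E' g'] /= /fsetP-> ->. Qed.

Lemma lamplighter_mulA : associative lamplighter_mul.
Proof.
move=> u v w; apply: lamplighter_eq => [x|]; last exact: mulgA.
by rewrite /= !(in_fsymdiff, in_fset_act) /= -addbA invgM thompson_actM.
Qed.

Lemma lamplighter_mul1 : left_id lamplighter_one lamplighter_mul.
Proof.
move=> u; apply: lamplighter_eq => [x|]; last exact: mul1g.
by rewrite /= !(in_fsymdiff, in_fset_act) /= invg1 thompson_act1.
Qed.

Lemma lamplighter_mulr1 : right_id lamplighter_one lamplighter_mul.
Proof.
move=> u; apply: lamplighter_eq => [x|]; last exact: mulg1.
by rewrite /= !(in_fsymdiff, in_fset_act) /= addbF.
Qed.

Lemma lamplighter_mulV :
  left_inverse lamplighter_one lamplighter_inv lamplighter_mul.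
Proof.
move=> u; apply: lamplighter_eq => [x|]; last exact: mulVg.
by rewrite /= !(in_fsymdiff, in_fset_act) /= addbb.
Qed.

Lemma lamplighter_mulrV :
  right_inverse lamplighter_one lamplighter_inv lamplighter_mul.
Proof.
move=> u; apply: lamplighter_eq => [x|]; last exact: mulgV.
rewrite /= !(in_fsymdiff, in_fset_act) /= invgK.
by rewrite -thompson_actM mulgV thompson_act1 addbb.
Qed.

HB.instance Definition _ := isGroup.Build lamplighter lamplighter_mulA
  lamplighter_mul1 lamplighter_mulr1 lamplighter_mulV lamplighter_mulrV.

Definition lamplighter_act (u : lamplighter) (E : {fset X}) : {fset X} :=
  fsymdiff (lamps u) (fset_act (position u) E).

Lemma lamplighter_act1 (E : {fset X}) : lamplighter_act 1%g E = E.
Proof.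
apply/fsetP => x; rewrite !(in_fsymdiff, in_fset_act).
by rewrite invg1 thompson_act1.
Qed.

Lemma lamplighter_actM (u v : lamplighter) (E : {fset X}) :
  lamplighter_act (u * v)%g E = lamplighter_act u (lamplighter_act v E).
Proof.
apply/fsetP => x; rewrite !(in_fsymdiff, in_fset_act).
by rewrite -addbA invgM thompson_actM.
Qed.

Definition min_fun (phi : X -> R) (E : {fset X}) : R :=
  if enum_fset E is x :: s then \big[Num.min/phi x]_(y <- s) phi y
  else phi thompson_root.

End Action.

(* Main.v *)
Require Import Defs.
From HB Require Import structures.
From mathcomp Require Import all_boot all_order all_algebra finmap.
From mathcomp Require Import all_classical all_reals all_analysis.
From mathcomp Require Import ring lra zify.
Import Order.TTheory GRing.Theory Num.Theory.
Import numFieldNormedType.Exports.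

Set Implicit Arguments.
Unset Strict Implicit.
Unset Printing Implicit Defensive.

Local Open Scope classical_set_scope.
Local Open Scope ring_scope.

(* The Schreier graph of X has rays a^-j z (z <= 1/2) and b^-j z (z >= 3/4)
   running to the ends 0 and 1 of the interval. A positive superharmonic
   function is concave along a ray, so its values u_j satisfy
   j |u_i - u_j| <= |i - j| u_j. An element of F is linear near 0 and near 1,
   hence shifts the far part of every ray by a bounded amount and changes all
   positive superharmonic functions there by a factor uniformly close to 1.
   On the other hand the set T_n of points within 2^-(n+2) of 0 or 1 is reached
   from every point in at most n + 4 steps, so the simple random walk almost
   surely hits T_n, and the values of a positive superharmonic function at
   finitely many given points dominate, up to a factor 1 - e, its minimum over
   a finite subset of T_n that does not depend on the function. Take E_n to be
   such a subset for the first n points of X. Then lamps switched on by a fixed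
   group element barely affect any of the min-functions, and for large n the
   group element switches off no lamp of g E_n. All these estimates are uniform
   in i, so they pass to the sum of the series. *)

(** * Nonnegative concave sequences *)

Section ConcaveSequence.
Variables (R : realType) (u : nat -> R).
Hypothesis u_ge0 : forall j, 0 <= u j.
Hypothesis u_concave : forall j, u j + u j.+2 <= 2 * u j.+1.

(** A negative increment would persist by concavity and drive the sequence below zero at linear
    speed. *)
Lemma concave_seq_nondecreasing : {homo u : i j / (i <= j)%N >-> i <= j}.
Proof.
apply: homo_leq => // [x y z|j]; first exact: le_trans.
rewrite leNgt; apply/negP => dlt.
have step k : u (j + k).+1 - u (j + k)%N <= u j.+1 - u j.
  elim: k => [|k IH]; first by rewrite addn0.
  by have := u_concave (j + k); rewrite addnS; lra.
have lin k : u (j + k)%N <= u j + k%:R * (u j.+1 - u j).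
  elim: k => [|k IH]; first by rewrite addn0 mul0r addr0.
  by have := step k; rewrite addnS -natr1; lra.
have d0 : 0 < u j - u j.+1 by rewrite subr_gt0.
have := archi_boundP (divr_ge0 (u_ge0 j) (ltW d0)).
rewrite ltr_pdivrMr //; set N := Num.bound _ => big.
by have := lin N; have := u_ge0 (j + N)%N; lra.
Qed.

(** Since [u 0] is nonnegative, concavity makes [u j / j] nonincreasing; clearing denominators
    includes index 0. *)
Lemma concave_seq_ratio i j : (i <= j)%N -> i%:R * u j <= j%:R * u i.
Proof.
move=> /subnKC <-; elim: (j - i)%N => [|k]; first by rewrite addn0.
rewrite addnS; set n := (i + k)%N => IH.
have step m : m%:R * u m.+1 <= m.+1%:R * u m.
  elim: m => [|m IHm]; first by rewrite mul0r mul1r.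
  have := ler_wpM2l (ler0n R m.+1) (u_concave m).
  by move: IHm; rewrite -!natr1; lra.
(* The two estimates are chained by cancelling the factor [n], so [n = 0], which forces [i = 0], is
   treated apart. *)
have [n0|n0] := posnP n.
  have -> : i = 0%N by move: n0; rewrite /n; lia.
  by rewrite mul0r mulr_ge0.
rewrite -(ler_pM2l (_ : 0 < n%:R :> R)) ?ltr0n //.
have := ler_wpM2l (ler0n R i) (step n); have := ler_wpM2l (ler0n R n.+1) IH.
by lra.
Qed.

Lemma concave_seq_dist i j : j%:R * `|u i - u j| <= `|i%:R - j%:R| * u j.
Proof.
have [ij|/ltnW ji] := leqP i j.
  have := concave_seq_ratio ij; have := concave_seq_nondecreasing ij.
  have : i%:R <= j%:R :> R by rewrite ler_nat.
  by move=> *; rewrite !ler0_norm; lra.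
have := concave_seq_ratio ji; have := concave_seq_nondecreasing ji.
have : j%:R <= i%:R :> R by rewrite ler_nat.
by move=> *; rewrite !ger0_norm; lra.
Qed.

End ConcaveSequence.

(** * Superharmonic functions along the rays *)

Section Rays.
Variable R : realType.
Local Notation X := (dyadic01 R).
Local Notation a := (thompson_a R).
Local Notation b := (thompson_b R).
Implicit Types (g c d : thompsonF R) (x z : X) (phi : X -> R).

Lemma dyadic01P x : dyadic (val x) /\ 0 < val x < 1.
Proof. exact: set_mem (valP x). Qed.

Lemma dyadic01_gt0 x : 0 < val x.
Proof. by have [_ /andP[]] := dyadic01P x. Qed.

Lemma dyadic01_lt1 x : val x < 1.
Proof. by have [_ /andP[]] := dyadic01P x. Qed.

Lemma dyadic01_exists (r : R) : dyadic r -> 0 < r < 1 -> exists x, val x = r.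
Proof.
move=> dr r01; have rX : r \in X by exact/mem_set.
by exists (SigSub rX).
Qed.

Lemma thompson_funV g (r s : R) : g r = s -> (g^-1)%g s = r.
Proof. by move=> <-; exact: (thompson_invK g).1. Qed.

Lemma thompson_actV_fix g x : thompson_act g x = x -> thompson_act g^-1%g x = x.
Proof. by move=> e; rewrite -{1}e thompson_actK. Qed.

(** Near 0 the map [a], and near 1 the map [b], doubles the distance to the end, so it is the
    inverse that runs towards the end. *)
Definition ray c z (j : nat) : X := iter j (thompson_act c^-1%g) z.

Lemma ray_a z j : val z <= 1 / 2 ->
  val (ray a z j) = val z / 2 ^+ j.
Proof.
move=> z12; elim: j => [|j IH]; first by rewrite expr0 divr1.
rewrite /ray iterS -/(ray a z j); apply: thompson_funV.
rewrite IH exprS invfM /=.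
have z0 := dyadic01_gt0 z; set t := 2 ^+ j.
have t1 : 1 <= t by rewrite exprn_ege1 // ler1n.
have zt0 : 0 < val z / t by rewrite divr_gt0 // (lt_le_trans ltr01).
have zt1 : val z / t <= 1 / 2.
  by apply: le_trans z12; rewrite ler_pdivrMr ?ler_peMr ?(lt_le_trans ltr01) // ltW.
rewrite mulrCA; move: (val z / t) zt0 zt1 => w w0 w12; rewrite /afun.
by repeat case: ifP => [|/negbT]; rewrite -?ltNge; lra.
Qed.

Lemma ray_b z j : 1 - val z <= 1 / 4 ->
  1 - val (ray b z j) = (1 - val z) / 2 ^+ j.
Proof.
move=> z14; elim: j => [|j IH]; first by rewrite expr0 divr1.
rewrite /ray iterS -/(ray b z j); set y := ray b z j in IH *.
set t := 2 ^+ j in IH.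
have z1 := dyadic01_lt1 z.
have t1 : 1 <= t by rewrite exprn_ege1 // ler1n.
have zt0 : 0 < (1 - val z) / t.
  by rewrite divr_gt0 ?subr_gt0 // (lt_le_trans ltr01).
have zt1 : (1 - val z) / t <= 1 / 4.
  apply: le_trans z14; rewrite ler_pdivrMr ?(lt_le_trans ltr01) //.
  by rewrite ler_peMr // subr_ge0 ltW.
rewrite exprS invfM -/t mulrCA -IH.
suff -> : val (thompson_act b^-1%g y) = (1 + val y) / 2 by field.
apply: thompson_funV; rewrite -{}IH in zt0 zt1.
move: (val y) zt0 zt1 => w w0 w14; rewrite /= /bfun.
by repeat case: ifP => [|/negbT]; rewrite -?ltNge; lra.
Qed.

(** The other generator [d] fixes the ray pointwise, so two of the four neighbours of a ray point
    are the point itself, and superharmonicity reduces to concavity of the values. *)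
Lemma ray_dist phi c d z :
  (forall x, 0 <= phi x) ->
  (forall x, 1 / 4 * (phi (thompson_act c x) + phi (thompson_act d x)
    + phi (thompson_act c^-1%g x) + phi (thompson_act d^-1%g x)) <= phi x) ->
  (forall j, thompson_act d (ray c z j) = ray c z j) ->
  forall i j, j%:R * `|phi (ray c z i) - phi (ray c z j)|
              <= `|i%:R - j%:R| * phi (ray c z j).
Proof.
move=> phi0 sh fx i j.
apply: (@concave_seq_dist _ (phi \o ray c z)) => [k|k]; first exact: phi0.
rewrite /comp; have e : thompson_act c (ray c z k.+1) = ray c z k.
  by rewrite /ray iterS -thompson_actM mulgV thompson_act1.
have := sh (ray c z k.+1).
rewrite e (thompson_actV_fix (fx k.+1)) (fx k.+1).
by rewrite -[thompson_act c^-1%g (ray c z k.+1)]/(ray c z k.+2); lra.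
Qed.

Lemma a_ray_dist phi z : (forall x, 0 <= phi x) -> superharmonic phi ->
  val z <= 1 / 2 ->
  forall i j, j%:R * `|phi (ray a z i) - phi (ray a z j)|
              <= `|i%:R - j%:R| * phi (ray a z j).
Proof.
move=> phi0 sh z12; apply: (@ray_dist _ _ b) => // j; apply: val_inj => /=.
rewrite ray_a // /bfun ifT //.
apply: le_trans z12; rewrite ler_pdivrMr ?exprn_gt0 // ler_peMr //.
  by rewrite ltW ?dyadic01_gt0.
by rewrite exprn_ege1 // ler1n.
Qed.

Lemma b_ray_dist phi z : (forall x, 0 <= phi x) -> superharmonic phi ->
  1 - val z <= 1 / 4 ->
  forall i j, j%:R * `|phi (ray b z i) - phi (ray b z j)|
              <= `|i%:R - j%:R| * phi (ray b z j).
Proof.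
move=> phi0 sh z14; apply: (@ray_dist _ _ a) => // [x|j].
  by have := sh x; lra.
apply: val_inj; rewrite -[LHS]/(afun (val (ray b z j))); have := ray_b j z14.
set y := ray b z j => yE.
have y14 : 1 - val y <= 1 / 4.
  rewrite yE; apply: le_trans z14; rewrite ler_pdivrMr ?exprn_gt0 // ler_peMr //.
    by rewrite subr_ge0 ltW ?dyadic01_lt1.
  by rewrite exprn_ege1 // ler1n.
move: (val y) {yE} y14 => w w14; rewrite /afun.
by repeat case: ifP => [|/negbT]; rewrite -?ltNge; lra.
Qed.

End Rays.

(** * Elements of F near 0 and 1 *)

Section Ends.
Variable R : realType.
Local Notation X := (dyadic01 R).
Local Notation a := (thompson_a R).
Local Notation b := (thompson_b R).
Implicit Types (g c d : thompsonF R) (x z : X) (phi : X -> R).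

(** The point [r] may itself be in [s], hence the puncture; [e <= 1] keeps the one-sided
    neighbourhoods of 0 and 1 inside the unit interval. *)
Lemma punctured_nbhs_avoid (s : seq R) (r : R) :
  exists2 e : R, 0 < e <= 1 & forall t, t \in s -> ~~ (0 < `|t - r| < e).
Proof.
elim: s => [|t s [e /andP[e0 e1] es]]; first by exists 1; rewrite ?ltr01 ?lexx.
have [->|tr] := eqVneq t r.
  exists e; rewrite ?e0 // => u; rewrite inE => /orP[/eqP->|/es//].
  by rewrite subrr normr0 ltxx.
have d0 : 0 < `|t - r| by rewrite normr_gt0 subr_eq0.
exists (Num.min e `|t - r|); first by rewrite lt_min e0 d0 ge_min e1.
move=> u; rewrite inE lt_min => /orP[/eqP->|/es]; first by rewrite ltxx !andbF.
by apply: contraNN => /and3P[-> -> _].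
Qed.

Lemma thompson_germ0 g : exists (k : int) (e : R),
  0 < e /\ forall r, 0 <= r <= e -> g r = 2 ^ k * r.
Proof.
have [s [_ sp]] := thompson_pl g.
have [e /andP[e0 e1] es] := punctured_nbhs_avoid s 0.
have [|k [c kc]] := sp 0 e (lexx 0) e0 e1.
  move=> t /es; apply: contraNN => /andP[t0 te].
  by rewrite subr0 gtr0_norm // t0.
have c0 : c = 0.
  have := kc 0; rewrite homeo01_0 ?lexx ?(ltW e0); last exact: thompson_homeo.
  by rewrite mulr0 add0r => /(_ isT).
by exists k, e; split => // r /kc ->; rewrite c0 addr0.
Qed.

Lemma thompson_germ1 g : exists (k : int) (e : R),
  0 < e /\ forall r, 0 <= 1 - r <= e -> 1 - g r = 2 ^ k * (1 - r).
Proof.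
have [s [_ sp]] := thompson_pl g.
have [e /andP[e0 e1] es] := punctured_nbhs_avoid s 1.
have [| | |k [c kc]] := sp (1 - e) 1 _ _ (lexx 1); [lra|lra| |].
  move=> t /es; apply: contraNN => /andP[te t1].
  by rewrite ltr0_norm ?subr_lt0 //; lra.
have g1 := homeo01_1 (thompson_homeo g).
have c1 : 1 = 2 ^ k + c by have := kc 1; rewrite g1 mulr1; apply; lra.
exists k, e; split => // r re; rewrite kc; last lra.
have -> : c = 1 - 2 ^ k by rewrite [X in X - _]c1; ring.
by ring.
Qed.

(** The offset 2 makes [2 ^+ n] times the distance to the end at most 1/4, so that [x] is the [n]-th
    point of a ray with an admissible base at either end. *)
Definition near_end (n : nat) x : Prop :=
  val x <= 2 ^- n.+2 \/ 1 - val x <= 2 ^- n.+2.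

Lemma exp2V_small (e : R) : 0 < e -> \forall n \near \oo, 2 ^- n <= e.
Proof.
move=> e0; near=> n; apply/ltW.
rewrite -[ltRHS]invrK ltf_pV2 ?posrE ?invr_gt0 ?exprn_gt0 //.
apply: lt_trans (_ : n%:R < _); first by near: n; exact: nbhs_infty_gtr.
by rewrite -natrX ltr_nat ltn_expl.
Unshelve. all: by end_near. Qed.

(** A germ of slope [2 ^ k] moves a ray point from index [n] to [n - k]; for [|k| <= n] the absolute
    value leaves this index unchanged. *)
Lemma germ_scale (k : int) (n : nat) (t : R) : (`|k| <= n)%N ->
  2 ^ k * (t / 2 ^+ n) = t / 2 ^+ `|n - k|%N.
Proof.
move=> kn; have nk : (`|n - k|%N : int) = n%:Z - k by lia.
have t0 : (2 : R) != 0 by [].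
have -> : 2 ^+ n = 2 ^ k * 2 ^+ `|n - k|%N :> R.
  by rewrite [LHS]exprnP [X in _ * X]exprnP nk -expfzDr // addrC subrK.
by field; rewrite expfz_neq0 // expf_neq0.
Qed.

Lemma germ_index_dist (k : int) (n : nat) : (`|k| <= n)%N ->
  `| `|n - k|%N%:R - n%:R| = `|k%:~R| :> R.
Proof.
move=> kn; have nk : (`|n - k|%N : int) = n%:Z - k by lia.
by rewrite [X in `|X - _|]pmulrn nk rmorphB /= addrAC subrr add0r normrN.
Qed.

Lemma near0_dist g : exists M : R, \forall n \near \oo,
  forall x, val x <= 2 ^- n.+2 ->
  forall phi, (forall y, 0 <= phi y) -> superharmonic phi ->
  n%:R * `|phi (thompson_act g x) - phi x| <= M * phi x.
Proof.
have [k [e [e0 ge]]] := thompson_germ0 g.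
exists `|k%:~R|; near=> n => x xn phi phi0 sh.
have kn : (`|k| <= n)%N by near: n; exact: nbhs_infty_ge.
have en : 2 ^- n <= e by near: n; exact: exp2V_small.
have x0 := dyadic01_gt0 x; have n0 : 0 < 2 ^+ n :> R by rewrite exprn_gt0.
have zle : 2 ^+ n * val x <= 1 / 4.
  rewrite mulrC -ler_pdivlMr //; apply: le_trans xn _.
  by rewrite !exprS !invfM; lra.
(* Base of the ray whose [n]-th point is [x]; it depends on [n], but the ray estimate does not
   depend on the base. *)
have [| |z zE] := @dyadic01_exists _ (2 ^+ n * val x).
- by rewrite -[2 ^+ n]/(2 ^ n%:Z); apply: dyadicMX; exact: (dyadic01P x).1.
- by apply/andP; split; [exact: mulr_gt0|lra].
have xz : x = ray a z n.
  by apply: val_inj; rewrite ray_a zE; [field; rewrite lt0r_neq0|lra].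
have gx : thompson_act g x = ray a z `|n - k|%N.
  apply: val_inj; rewrite ray_a; last by rewrite zE; lra.
  rewrite -germ_scale // -ray_a ?zE; last lra.
  rewrite -xz -ge //; rewrite ltW //=; apply: le_trans en; apply: le_trans xn _.
  by rewrite lef_pV2 ?posrE ?exprn_gt0 // ler_eXn2l ?ltr1n //; lia.
rewrite gx [in X in _ - X]xz [in X in _ <= _ * X]xz.
apply: le_trans (a_ray_dist phi0 sh _ _ _) _; first by rewrite zE; lra.
by rewrite ler_wpM2r // germ_index_dist.
Unshelve. all: by end_near. Qed.

(** Mirror image of the argument at 0, with distances to 1 in place of coordinates and [b] in place
    of [a]. *)
Lemma near1_dist g : exists M : R, \forall n \near \oo,
  forall x, 1 - val x <= 2 ^- n.+2 ->
  forall phi, (forall y, 0 <= phi y) -> superharmonic phi ->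
  n%:R * `|phi (thompson_act g x) - phi x| <= M * phi x.
Proof.
have [k [e [e0 ge]]] := thompson_germ1 g.
exists `|k%:~R|; near=> n => x xn phi phi0 sh.
have kn : (`|k| <= n)%N by near: n; exact: nbhs_infty_ge.
have en : 2 ^- n <= e by near: n; exact: exp2V_small.
have x0 : 0 < 1 - val x by rewrite subr_gt0 dyadic01_lt1.
have n0 : 0 < 2 ^+ n :> R by rewrite exprn_gt0.
have zle : 2 ^+ n * (1 - val x) <= 1 / 4.
  rewrite mulrC -ler_pdivlMr //; apply: le_trans xn _.
  by rewrite !exprS !invfM; lra.
have zgt0 : 0 < 2 ^+ n * (1 - val x) by exact: mulr_gt0.
have [| |z zE] := @dyadic01_exists _ (1 - 2 ^+ n * (1 - val x)).
- have d1 : dyadic (1 : R).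
    by exists 1, 0%N; rewrite expr0 divr1.
  apply: (dyadicD d1); apply: dyadicN; rewrite -[2 ^+ n]/(2 ^ n%:Z).
  exact: dyadicMX (dyadicD d1 (dyadicN (dyadic01P x).1)).
- by apply/andP; split; lra.
have z1 : 1 - val z = 2 ^+ n * (1 - val x) by rewrite zE; ring.
have val1_inj (y y' : X) : 1 - val y = 1 - val y' -> y = y'.
  by move=> yy'; apply: val_inj; lra.
have xz : x = ray b z n.
  by apply: val1_inj; rewrite ray_b z1 //; field; rewrite lt0r_neq0.
have gx : thompson_act g x = ray b z `|n - k|%N.
  apply: val1_inj; rewrite ray_b z1 //.
  rewrite -germ_scale // -z1 -ray_b ?z1 //.
  rewrite -xz -ge //; rewrite ltW //=; apply: le_trans en; apply: le_trans xn _.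
  by rewrite lef_pV2 ?posrE ?exprn_gt0 // ler_eXn2l ?ltr1n //; lia.
rewrite gx [in X in _ - X]xz [in X in _ <= _ * X]xz.
apply: le_trans (b_ray_dist phi0 sh _ _ _) _; first by rewrite z1.
by rewrite ler_wpM2r // germ_index_dist.
Unshelve. all: by end_near. Qed.

Lemma near_end_dist g : exists2 M : R, 0 <= M & \forall n \near \oo,
  forall x, near_end n x ->
  forall phi, (forall y, 0 <= phi y) -> superharmonic phi ->
  n%:R * `|phi (thompson_act g x) - phi x| <= M * phi x.
Proof.
have [M0 near0] := near0_dist g; have [M1 near1] := near1_dist g.
exists (Num.max 0 (Num.max M0 M1)); first by rewrite le_max lexx.
near=> n => x xn phi phi0 sh.
case: xn => xn; [apply: (le_trans (y := M0 * phi x))|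
                 apply: (le_trans (y := M1 * phi x))].
- move: x xn phi phi0 sh; near: n; exact: near0.
- by rewrite ler_wpM2r // !le_max lexx !orbT.
- move: x xn phi phi0 sh; near: n; exact: near1.
- by rewrite ler_wpM2r // !le_max lexx !orbT.
Unshelve. all: by end_near. Qed.

End Ends.

(** * Recurrence of neighbourhoods of the ends *)

Section Recurrence.
Variable R : realType.
Local Notation X := (dyadic01 R).
Local Notation a := (thompson_a R).
Local Notation b := (thompson_b R).
Implicit Types (g : thompsonF R) (x y z : X) (phi : X -> R) (T : X -> Prop).

Definition generators : seq (thompsonF R) := [:: a; b; a^-1%g; b^-1%g].

Fixpoint reach T (d : nat) x : Prop :=
  T x \/ if d is d'.+1 then
    exists2 s, s \in generators & reach T d' (thompson_act s x)
  else False.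

Lemma reach_iter T d s j x : s \in generators ->
  reach T d (iter j (thompson_act s) x) -> reach T (j + d) x.
Proof.
move=> sG; elim: j x => [//|j IH] x; rewrite iterSr => /IH r.
by rewrite addSn; right; exists s.
Qed.

Lemma reachW T d d' x : (d <= d')%N -> reach T d x -> reach T d' x.
Proof.
elim: d d' x => [|d IH] [|d'] x //= dd'; first by case => // ?; left.
case=> [|[s sG r]]; first by left.
by right; exists s => //; exact: IH r.
Qed.

Lemma reach_exists T d x : reach T d x -> exists y, T y.
Proof.
elim: d x => [|d IH] x [Tx|]; [by exists x|by []|by exists x|].
by move=> [s _ /IH].
Qed.

(** Points up to 1/2 descend under powers of the inverse of [a], points from 7/8 on climb under
    powers of the inverse of [b], and those in between are first brought below 1/2. *)
Lemma reach_end n x : reach (near_end n) (n + 4) x.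
Proof.
have aV : a^-1%g \in generators by rewrite !inE eqxx !orbT.
have bV : b^-1%g \in generators by rewrite !inE eqxx !orbT.
have bG : b \in generators by rewrite !inE eqxx !orbT.
have low y : val y <= 1 / 2 -> reach (near_end n) n.+1 y.
  move=> y12; rewrite -[n.+1]addn0; apply: (reach_iter aV).
  left; left; rewrite -/(ray a y n.+1) ray_a // exprS (exprS _ n.+1) !invfM.
  have : 0 <= 2 ^- n.+1 :> R by rewrite invr_ge0 exprn_ge0.
  have := y12; rewrite exprS invfM; nra.
(* Here [b] followed by the inverse of [a] is translation by -1/4. *)
have mid y : 1 / 2 < val y <= 3 / 4 -> reach (near_end n) n.+3 y.
  move=> /andP[y12 y34]; right; exists b => //.
  right; exists a^-1%g => //; apply: low.
  set w := thompson_act b y.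
  have wE : val w = val y / 2 + 1 / 4.
    rewrite -[val w]/(bfun (val y)).
    by move: (val y) y12 y34 => r r12 r34; rewrite /bfun ifF ?ifT //; lra.
  suff -> : val (thompson_act a^-1%g w) = 2 * val w - 3 / 4 by lra.
  apply: thompson_funV; rewrite -[LHS]/(afun (2 * val w - 3 / 4)).
  move: (val w) wE => r ->; rewrite /afun.
  by repeat case: ifP => [|/negbT]; rewrite -?ltNge; lra.
have high y : 3 / 4 < val y <= 7 / 8 -> reach (near_end n) n.+4 y.
  move=> /andP[y34 y78]; right; exists b => //; apply: mid.
  rewrite -[val (thompson_act b y)]/(bfun (val y)).
  move: (val y) y34 y78 => r r34 r78; rewrite /bfun.
  by repeat case: ifP => [|/negbT]; rewrite -?ltNge; lra.
have top y : 1 - val y <= 1 / 8 -> reach (near_end n) n y.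
  move=> y18; rewrite -[n]addn0; apply: (reach_iter bV).
  left; right; rewrite addn0 -/(ray b y n) ray_b; last lra.
  rewrite !exprS !invfM.
  have : 0 <= 2 ^- n :> R by rewrite invr_ge0 exprn_ge0.
  by nra.
have [x12|x12] := leP (val x) (1 / 2).
  by apply: reachW (low x x12); lia.
have [x34|x34] := leP (val x) (3 / 4).
  by apply: reachW (mid x _); [lia|rewrite x12].
have [x78|x78] := leP (val x) (7 / 8).
  by rewrite addn4; apply: high; rewrite x34.
by apply: reachW (top x _); [lia|lra].
Qed.

Section Dominated.
Variable T : X -> Prop.

(* [al] plays the role of a lower bound for the probability that the walk
   started at [x] hits [S]; the same [S] serves all functions [phi]. *)
Definition dominated x (al : R) : Prop :=
  exists2 S : {fset X}, (forall y, y \in S -> T y) &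
  forall phi (c : R), (forall y, 0 <= phi y) -> superharmonic phi -> 0 <= c ->
  (forall y, y \in S -> c <= phi y) -> al * c <= phi x.

Lemma dominated_in x : T x -> dominated x 1.
Proof.
move=> Tx; exists [fset x]%fset => [y|phi c _ _ _ S].
  by rewrite inE => /eqP->.
by rewrite mul1r S // inE.
Qed.

Lemma dominatedW x (al be : R) : be <= al -> dominated x al -> dominated x be.
Proof.
move=> ba [S ST D]; exists S => // phi c p0 sh c0 cS.
by apply: le_trans (D phi c p0 sh c0 cS); rewrite ler_wpM2r.
Qed.

Lemma dominated0 x : dominated x 0.
Proof. by exists fset0 => // phi c p0 _ _ _; rewrite mul0r. Qed.

(** Conditioning on the first step of the walk: a lower bound on the union of the four sets is one
    on each of them. *)
Lemma dominated_avg x (al1 al2 al3 al4 : R) :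
  dominated (thompson_act a x) al1 -> dominated (thompson_act b x) al2 ->
  dominated (thompson_act a^-1%g x) al3 ->
  dominated (thompson_act b^-1%g x) al4 ->
  dominated x ((al1 + al2 + al3 + al4) / 4).
Proof.
move=> [S1 T1 D1] [S2 T2 D2] [S3 T3 D3] [S4 T4 D4].
exists (S1 `|` S2 `|` (S3 `|` S4))%fset => [y|phi c p0 sh c0 cS].
  by rewrite !inE => /orP[/orP[/T1|/T2]|/orP[/T3|/T4]].
have l1 := D1 phi c p0 sh c0; have l2 := D2 phi c p0 sh c0.
have l3 := D3 phi c p0 sh c0; have l4 := D4 phi c p0 sh c0.
have {}l1 : al1 * c <= phi (thompson_act a x).
  by apply: l1 => y yS; apply: cS; rewrite !inE yS ?orbT.
have {}l2 : al2 * c <= phi (thompson_act b x).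
  by apply: l2 => y yS; apply: cS; rewrite !inE yS ?orbT.
have {}l3 : al3 * c <= phi (thompson_act a^-1%g x).
  by apply: l3 => y yS; apply: cS; rewrite !inE yS ?orbT.
have {}l4 : al4 * c <= phi (thompson_act b^-1%g x).
  by apply: l4 => y yS; apply: cS; rewrite !inE yS ?orbT.
by apply: le_trans (sh x); lra.
Qed.

Lemma dominated_step x s (al be : R) : (forall y, dominated y al) ->
  s \in generators -> dominated (thompson_act s x) be ->
  dominated x (3 / 4 * al + 1 / 4 * be).
Proof.
move=> Dal; rewrite !inE => /or4P[]/eqP-> Dbe.
- by have := dominated_avg Dbe (Dal _) (Dal _) (Dal _); apply: dominatedW; lra.
- by have := dominated_avg (Dal _) Dbe (Dal _) (Dal _); apply: dominatedW; lra.
- by have := dominated_avg (Dal _) (Dal _) Dbe (Dal _); apply: dominatedW; lra.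
- by have := dominated_avg (Dal _) (Dal _) (Dal _) Dbe; apply: dominatedW; lra.
Qed.

(* From [x], a path of length at most [d] into [T] has probability at least
   [(1 / 4) ^+ d]. *)
Lemma dominated_reach (al : R) d x : al <= 1 -> (forall y, dominated y al) ->
  reach T d x -> dominated x (1 - (1 - al) * (1 - (1 / 4) ^+ d)).
Proof.
move=> al1 Dal; elim: d x => [|d IH] x [Tx|] //.
- by rewrite expr0 subrr mulr0 subr0; exact: dominated_in.
- apply: dominatedW (dominated_in Tx).
  rewrite gerBl mulr_ge0 ?subr_ge0 // exprn_ile1 //; lra.
(* The factor of [1 - al] becomes 3/4 + 1/4 (1 - (1/4)^d) = 1 - (1/4)^(d+1). *)
- move=> [s sG /IH /(dominated_step Dal sG)].
  by apply: dominatedW; rewrite exprS; lra.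
Qed.

(** As [d] serves all starting points, every round of [d] steps multiplies the defect by the same
    [q < 1]; starting from the trivial bound 0, [N] rounds leave the defect [q ^+ N]. *)
Lemma dominated_recurrent d : (forall x, reach T d x) ->
  forall (e : R) x, 0 < e -> dominated x (1 - e).
Proof.
move=> rT e x e0; set q : R := 1 - (1 / 4) ^+ d.
have q01 : 0 <= q < 1.
  by rewrite /q subr_ge0 exprn_ile1 ?gtrBl ?exprn_gt0 //; lra.
have DN N : forall y, dominated y (1 - q ^+ N).
  elim: N => [|N IH] y; first by rewrite expr0 subrr; exact: dominated0.
  have := dominated_reach _ IH (rT y).
  rewrite gerBl exprn_ge0 ?(andP q01).1 // => /(_ isT).
  by rewrite subKr -/q mulrC -exprS.
have [N qN] : exists N, q ^+ N <= e.
  have /andP[q0 q1] := q01.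
  have /cvgrPdist_le/(_ e e0) [N _ /(_ N (leqnn N))] :
    (GRing.exp q : R ^nat) @ \oo --> 0 by apply: cvg_expr; rewrite ger0_norm.
  by rewrite /= sub0r normrN ger0_norm ?exprn_ge0 //; exists N.
by apply: dominatedW (DN N x); rewrite lerB.
Qed.

End Dominated.

End Recurrence.

(** * Almost invariant sets for min-functions *)

Section MinFun.
Variable R : realType.
Local Notation X := (dyadic01 R).
Implicit Types (x y : X) (phi : X -> R) (E : {fset X}).

Lemma min_fun_le phi E x : x \in E -> min_fun phi E <= phi x.
Proof.
rewrite -[x \in E]/(x \in enum_fset E) /min_fun.
case: (enum_fset E) => [//|y s]; elim: s => [|z s IH].
  by rewrite inE big_nil => /eqP->.
rewrite big_cons !inE ge_min => /or3P[xy|/eqP->|xs]; last 2 first.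
- by rewrite lexx.
- by rewrite IH ?orbT // inE xs orbT.
- by rewrite IH ?orbT // inE xy.
Qed.

Lemma min_fun_attained phi E : E != fset0 ->
  exists2 x, x \in E & min_fun phi E = phi x.
Proof.
move=> /fset0Pn[x0 x0E].
suff : exists2 x, x \in enum_fset E & min_fun phi E = phi x.
  by move=> [x xE e]; exists x.
have : x0 \in enum_fset E := x0E.
rewrite /min_fun; case: (enum_fset E) => [//|y s] _; elim: s => [|z s [x xs IH]].
  by exists y; rewrite ?inE // big_nil.
rewrite big_cons; set m := \big[_/_]_(_ <- s) _ in IH *.
have [_|_] := leP (phi z) m; first by exists z; rewrite // !inE eqxx orbT.
by exists x => //; move: xs; rewrite !inE => /orP[->|->]; rewrite ?orbT.
Qed.

Lemma min_fun0 phi : min_fun phi fset0 = phi (thompson_root R).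
Proof.
rewrite /min_fun; case e : (enum_fset fset0) => [//|y s].
suff : y \in (fset0 : {fset X}) by rewrite inE.
by rewrite -[_ \in _]/(y \in enum_fset fset0) e mem_head.
Qed.

Lemma min_fun_gt0 phi E : (forall x, 0 < phi x) -> 0 < min_fun phi E.
Proof.
move=> phi0; have [->|/(min_fun_attained phi)[x _ ->//]] := eqVneq E fset0.
by rewrite min_fun0.
Qed.

(** This comparison gives convergence of the series of min-functions at every finite set, the empty
    one included. *)
Lemma min_fun_le_root phi E : (forall x, phi x <= phi (thompson_root R)) ->
  min_fun phi E <= phi (thompson_root R).
Proof.
move=> phip; have [->|/(min_fun_attained phi)[x _ ->//]] := eqVneq E fset0.
by rewrite min_fun0.
Qed.

End MinFun.

(** Serves to treat the finitely many lamps of a group element simultaneously. *)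
Lemma near_seq_forall (I : eqType) (s : seq I) (P : I -> nat -> Prop) :
  (forall i, i \in s -> \forall n \near \oo, P i n) ->
  \forall n \near \oo, forall i, i \in s -> P i n.
Proof.
elim: s => [|i s IH] sP; first exact: nearW.
have Pi := sP i (mem_head _ _).
have Ps := IH (fun j js => sP j (mem_behead (s := i :: s) js)).
near=> n => j; rewrite inE => /orP[/eqP->|js]; first by near: n.
by move: j js; near: n.
Unshelve. all: by end_near. Qed.

(** * Dominating sets near the ends and their almost invariance *)

Section FolnerSets.
Variable R : realType.
Local Notation X := (dyadic01 R).
Implicit Types (x y : X) (phi : X -> R) (E : {fset X}).

Lemma dyadic01_enum : exists en : nat -> X, forall x, exists j, en j = x.
Proof.
pose r (j : nat) : R :=
  if choice.unpickle j is Some (m, n) then (m : int)%:~R / 2 ^+ (n : nat) else 0.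
(* Numbers outside [X] are sent to the root. *)
exists (fun j => insubd (thompson_root R) (r j)) => x.
have [[m [n xE]] _] := dyadic01P x; exists (choice.pickle (m, n)).
by rewrite /r choice.pickleK -xE valKd.
Qed.

Lemma dominating_sets (en : nat -> X) (n : nat) : exists E : {fset X},
  [/\ E != fset0, forall y, y \in E -> near_end n y &
    forall j, (j < n)%N -> forall phi, (forall y, 0 <= phi y) ->
    superharmonic phi -> (1 - n.+1%:R^-1) * min_fun phi E <= phi (en j)].
Proof.
have [y0 y0n] := reach_exists (reach_end n (thompson_root R)).
(* An arbitrary lower bound [c] replaces the minimum, so that enlarging [E] preserves the estimates
   already obtained; [n] stays fixed while [m] grows. *)
suff dom m : exists E : {fset X},
  [/\ E != fset0, forall y, y \in E -> near_end n y &
    forall j, (j < m)%N -> forall phi, (forall y, 0 <= phi y) ->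
    superharmonic phi -> forall c, 0 <= c -> (forall y, y \in E -> c <= phi y) ->
    (1 - n.+1%:R^-1) * c <= phi (en j)].
  have [E [E0 En D]] := dom n; exists E; split => // j jn phi phi0 sh.
  apply: D => // [|y]; last exact: min_fun_le.
  by have [x _ ->] := min_fun_attained phi E0.
elim: m => [|m [E [E0 En D]]].
  (* The seed [y0] keeps the set nonempty, so that its min-function is a true minimum and not the
     value at the root. *)
  exists [fset y0]%fset; split => //; last by move=> y; rewrite inE => /eqP->.
  by apply/fset0Pn; exists y0; rewrite inE.
have [|S ST DS] := dominated_recurrent (reach_end n) (en m) (e := n.+1%:R^-1).
  by rewrite invr_gt0.
exists (E `|` S)%fset; split.
- by have /fset0Pn[y yE] := E0; apply/fset0Pn; exists y; rewrite inE yE.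
- by move=> y; rewrite inE => /orP[/En|/ST].
- move=> j; rewrite ltnS leq_eqVlt => /orP[/eqP->|jm] phi phi0 sh c c0 cE.
    by apply: DS => // y yS; apply: cE; rewrite inE yS orbT.
  by apply: D => // y yE; apply: cE; rewrite inE yE.
Qed.

Lemma near_end_avoid x : \forall n \near \oo, ~ near_end n x.
Proof.
pose e := Num.min (val x) (1 - val x).
have e0 : 0 < e by rewrite lt_min dyadic01_gt0 subr_gt0 dyadic01_lt1.
near=> n; have : 2 ^- n <= e by near: n; exact: exp2V_small.
rewrite le_min => /andP[n0 n1].
have : 2 ^- n.+2 < 2 ^- n :> R.
  by rewrite ltf_pV2 ?posrE ?exprn_gt0 // ltr_eXn2l ?ltr1n //.
by move=> nn [] ?; lra.
Unshelve. all: by end_near. Qed.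

(** Upper bound: the image of a minimiser over [E] is not switched off. Lower bound: a minimiser
    over the new set is either a lamp of [u] or the image of a point of [E]. *)
Lemma min_fun_ratio phi E (u : lamplighter R) (e : R) :
  E != fset0 -> (forall x, 0 <= phi x) ->
  (forall x, x \in lamps u -> thompson_act (position u)^-1%g x \notin E) ->
  (forall x, x \in lamps u -> (1 - e) * min_fun phi E <= phi x) ->
  (forall x, x \in E ->
    `|phi (thompson_act (position u) x) - phi x| <= e * phi x) ->
  e <= 1 ->
  (1 - e) * min_fun phi E <= min_fun phi (lamplighter_act u E)
    <= (1 + e) * min_fun phi E.
Proof.
move=> E0 phi0 LE Lmin gE e1; have [x xE xmin] := min_fun_attained phi E0.
have gxu : thompson_act (position u) x \in lamplighter_act u E.
  rewrite in_fsymdiff in_fset_act thompson_actK xE.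
  by rewrite addbT; apply/negP => /LE; rewrite thompson_actK xE.
apply/andP; split; last first.
  apply: le_trans (min_fun_le _ gxu) _; rewrite xmin.
  by have := gE x xE; rewrite ler_norml; lra.
have [|y + ->] := @min_fun_attained _ phi (lamplighter_act u E).
  by apply/fset0Pn; exists (thompson_act (position u) x).
rewrite in_fsymdiff in_fset_act; case: (boolP (y \in lamps u)) => [yL _|_ /= yE].
  exact: Lmin.
have := gE _ yE; rewrite -thompson_actM mulgV thompson_act1 ler_norml.
have := min_fun_le phi yE; set y' := thompson_act _ y => my.
have : (1 - e) * min_fun phi E <= (1 - e) * phi y' by rewrite ler_wpM2l ?subr_ge0.
by lra.
Qed.

End FolnerSets.

(** * Passage to the sum of the series *)

Lemma lim_series_ratio (R : realType) (m m' : nat -> R) (e : R) :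
  (forall i, 0 < m i) -> cvgn (series m) -> cvgn (series m') ->
  (forall i, (1 - e) * m i <= m' i <= (1 + e) * m i) ->
  `|1 - limn (series m') / limn (series m)| <= e.
Proof.
move=> m0 cm cm' mm'.
(* The sum dominates its positive first term, so division by it preserves the inequalities. *)
have lm0 : 0 < limn (series m).
  apply: lt_le_trans (m0 0%N) _.
  have : series m 1 <= limn (series m).
    apply: nondecreasing_cvgn_le cm _.
    by apply/nondecreasing_seqP => n; rewrite /series /= big_nat_recr //= lerDl ltW.
  by rewrite /series /= big_nat1.
have lo : (1 - e) * limn (series m) <= limn (series m').
  rewrite -[_ * _]/((1 - e) *: limn (series m)) -lim_seriesZ //.
  apply: lim_series_le => // [|i]; first exact: is_cvg_seriesZ.
  by case/andP: (mm' i).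
have hi : limn (series m') <= (1 + e) * limn (series m).
  rewrite -[_ * _]/((1 + e) *: limn (series m)) -lim_seriesZ //.
  apply: lim_series_le => // [|i]; first exact: is_cvg_seriesZ.
  by case/andP: (mm' i).
rewrite -ler_pdivlMr // in lo; rewrite -ler_pdivrMr // in hi.
by rewrite ler_norml; lra.
Qed.

Theorem theorem15 (R : realType) (phi : nat -> dyadic01 R -> R)
  (phi_gt0 : forall i x, 0 < phi i x)
  (phi_superharmonic : forall i, superharmonic (phi i))
  (phi_le_root : forall i q, phi i q <= phi i (thompson_root R))
  (phi_summable : cvgn (series (fun i => phi i (thompson_root R)))) :
  let f := fun E : {fset dyadic01 R} => limn (series (fun i => min_fun (phi i) E)) in
  exists E : nat -> {fset dyadic01 R},
    forall g : lamplighter R,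
      (f (lamplighter_act g (E n)) / f (E n)) @[n --> \oo] --> (1 : R).
Proof.
move=> f; have [en enP] := dyadic01_enum R.
have [E EP] := choice (dominating_sets en); exists E => u.
have phi_ge0 i x : 0 <= phi i x by rewrite ltW.
have cvg_min A : cvgn (series (fun i => min_fun (phi i) A)).
  apply: series_le_cvg phi_summable => i //; first by rewrite ltW ?min_fun_gt0.
  exact: min_fun_le_root.
have [M M0 near_dist] := near_end_dist (position u).
have near_enum : \forall n \near \oo, forall x, x \in enum_fset (lamps u) ->
    exists2 j, (j < n)%N & en j = x.
  apply: near_seq_forall => x _; have [j jx] := enP x.
  by near=> n; exists j => //; near: n; exact: nbhs_infty_gt.
have near_avoid : \forall n \near \oo, forall x, x \in enum_fset (lamps u) ->
    ~ near_end n (thompson_act (position u)^-1%g x).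
  by apply: near_seq_forall => x _; exact: near_end_avoid.
(* The restriction [e <= 1] keeps the factor [1 - e] nonnegative in [min_fun_ratio]. *)
suff ratio (e : R) : 0 < e <= 1 -> \forall n \near \oo,
    `|1 - f (lamplighter_act u (E n)) / f (E n)| <= e.
  apply/cvgrPdist_le => e e0.
  have /ratio : 0 < Num.min e 1 <= 1 by rewrite lt_min e0 ltr01 ge_min lexx orbT.
  by apply: filterS => n /le_trans; apply; rewrite ge_min lexx.
move=> /andP[e0 e1]; near=> n.
have n0 : 0 < n%:R :> R by rewrite ltr0n; near: n; exact: nbhs_infty_gt.
(* This bound absorbs the displacement [M / n] into [e], and the next one the loss 1/(n+1) of
   [dominating_sets]. *)
have ne : M / e < n%:R by near: n; exact: nbhs_infty_gtr.
have ne' : e^-1 < n%:R by near: n; exact: nbhs_infty_gtr.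
have [E0 En D] := EP n.
apply: lim_series_ratio => // i; first exact: min_fun_gt0.
apply: min_fun_ratio => // [x xL|x xL|x xE].
(* A preimage of a lamp in [E n] would be near an end, which fails for large [n]. *)
- by apply/negP => /En; move: x xL; near: n.
- have [j jn <-] : exists2 j, (j < n)%N & en j = x by move: x xL; near: n.
  apply: le_trans (D j jn (phi i) _ _) => //.
  rewrite ler_wpM2r ?(ltW (min_fun_gt0 _ _)) // lerB //.
  rewrite -[leRHS]invrK lef_pV2 ?posrE ?invr_gt0 //.
  by rewrite ltW // (lt_trans ne') // ltr_nat.
- rewrite -(ler_pM2l n0); apply: (le_trans (y := M * phi i x)).
    have xn := En x xE; move: x xn {xE} (phi i) (phi_ge0 i) (phi_superharmonic i).
    by near: n.
  by rewrite mulrA ler_wpM2r // -ler_pdivrMr // ltW.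
Unshelve. all: by end_near. Qed.
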